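(* Let $M$ be a smooth $n$-manifold and let $f\colon M\to\mathbb{R}$ be a CS function on $M$, given as a continuous selection of smooth functions $f_1,\ldots,f_m\colon M\to\mathbb{R}$. Let $J\subset\{1,2,\ldots,m\}$ be any subset such that $I_f(x)=J$ for some $x\in M$. Then $M_J=\{x\in M : I_f(x)=J\}$ is a smooth submanifold of codimension $|J|-1$ in $M$.
   Context: Let $M$ be a smooth manifold and $f_1,\ldots,f_m\colon M\to\mathbb{R}$ smooth functions. A continuous function $f\colon M\to\mathbb{R}$ is a continuous selection of $f_1,\ldots,f_m$, written $f\in CS(f_1,\ldots,f_m)$, if (1) the active index set $I_f(x)=\{i\in\{1,\ldots,m\} : f(x)=f_i(x)\}$ is nonempty for every $x\in M$, and (2) for every $i\in\{1,\ldots,m\}$ there is $x\in M$ with $i\in I_f(x)$. The set of essentially active indices at $x_0$ is $\widehat I_f(x_0)=\{i : x_0\in \mathrm{cl}(\mathrm{int}\{x : f(x)=f_i(x)\})\}$. A CS function on $M$ is a function $f\colon M\to\mathbb{R}$ for which there are smooth functions $f_1,\ldots,f_m\colon M\to\mathbb{R}$ such that (1) $f\in CS(f_1,\ldots,f_m)$; (2) $I_f(x)=\widehat I_f(x)$ for every $x\in M$; (3) at every $x\in M$ the gradients of the active functions $\{f_j : j\in I_f(x)\}$ (taken e.g. in local coordinates) are affinely independent. ''Submanifold'' means embedded submanifold. *)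

(* Defs.v *)
From mathcomp Require Import all_boot all_order all_algebra.
From mathcomp Require Import boolp classical_sets reals topology normedtype.
From mathcomp Require Import derive.

Set Implicit Arguments.
Unset Strict Implicit.
Unset Printing Implicit Defensive.

Import Order.TTheory GRing.Theory Num.Theory.
Import numFieldNormedType.Exports.

Local Open Scope classical_set_scope.
Local Open Scope ring_scope.

(* Meant for U open: then the partial derivatives at points of U only depend
   on the restriction of g to U. *)
Fixpoint Ck_on (R : realType) (n : nat) (V : normedModType R) (k : nat)
    (U : set 'rV[R]_n) (g : 'rV[R]_n -> V) : Prop :=
  match k with
  | 0 => {within U, continuous g}
  | k'.+1 => (forall y, U y -> differentiable g y) /\
      forall i : 'I_n, Ck_on k' U (fun y => 'D_(delta_mx 0 i) g y)
  end.

Definition smooth_on (R : realType) (n : nat) (V : normedModType R)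
    (U : set 'rV[R]_n) (g : 'rV[R]_n -> V) : Prop :=
  forall k, Ck_on k U g.

(* A homeomorphism from an open subset of T onto an open subset of R^n. The
   values of the two total functions outside these open sets are irrelevant. *)
Record chart (R : realType) (n : nat) (T : topologicalType) := Chart {
  chart_dom : set T;
  chart_map :> T -> 'rV[R]_n;
  chart_inv : 'rV[R]_n -> T;
  chart_dom_open : open chart_dom;
  chart_img_open : open (chart_map @` chart_dom);
  chart_mapK : {in chart_dom, cancel chart_map chart_inv};
  chart_map_continuous : {within chart_dom, continuous chart_map};
  chart_inv_continuous : {within chart_map @` chart_dom, continuous chart_inv}
}.

Definition smooth_transition (R : realType) (n : nat) (T : topologicalType)
    (c d : chart R n T) : Prop :=
  smooth_on (c @` (chart_dom c `&` chart_dom d)) (d \o chart_inv c).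

Record smoothManifold (R : realType) (n : nat) := SmoothManifold {
  manifold_space :> topologicalType;
  manifold_hausdorff : hausdorff_space manifold_space;
  manifold_second_countable : @second_countable manifold_space;
  atlas : set (chart R n manifold_space);
  atlas_cover : forall x, exists2 c, atlas c & chart_dom c x;
  atlas_smooth : forall c d, atlas c -> atlas d -> smooth_transition c d
}.

(* Membership in the maximal atlas, i.e. in the smooth structure that the
   given atlas determines. *)
Definition smooth_chart (R : realType) (n : nat) (M : smoothManifold R n)
    (c : chart R n M) : Prop :=
  forall d, atlas d -> smooth_transition c d /\ smooth_transition d c.

Definition smooth_function (R : realType) (n : nat) (M : smoothManifold R n)
    (g : M -> R) : Prop :=
  forall c : chart R n M, atlas c ->
    smooth_on (c @` chart_dom c) (g \o chart_inv c).

(* Every point of S lies in a slice chart: a chart of the smooth structure in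
   which S is cut out by the vanishing of the last k coordinates, so that S
   corresponds to R^(n - k) x {0}. *)
Definition submanifold_codim (R : realType) (n : nat) (M : smoothManifold R n)
    (k : nat) (S : set M) : Prop :=
  (k <= n)%N /\
  forall p, S p -> exists c : chart R n M,
    [/\ smooth_chart c, chart_dom c p &
      c @` (S `&` chart_dom c) =
      c @` chart_dom c `&`
        [set y | forall i : 'I_n, (n - k <= i)%N -> y 0 i = 0]].

Definition gradient_in_chart (R : realType) (n : nat) (M : smoothManifold R n)
    (c : chart R n M) (g : M -> R) (x : M) : 'rV[R]_n :=
  \row_(i < n) 'D_(delta_mx 0 i) (g \o chart_inv c) (c x).

(* Affine independence of an indexed family: in particular the v j, j in J,
   are pairwise distinct. *)
Definition affinely_independent (R : realType) (V : lmodType R) (m : nat)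
    (J : {set 'I_m}) (v : 'I_m -> V) : Prop :=
  forall a : 'I_m -> R,
    \sum_(j in J) a j = 0 -> \sum_(j in J) a j *: v j = 0 ->
    forall j, j \in J -> a j = 0.

Definition active_set (R : realType) (T : Type) (m : nat)
    (f : T -> R) (fs : 'I_m -> T -> R) (x : T) : {set 'I_m} :=
  [set i | f x == fs i x]%SET.

Definition essentially_active_set (R : realType) (T : topologicalType)
    (m : nat) (f : T -> R) (fs : 'I_m -> T -> R) (x : T) : {set 'I_m} :=
  [set i | `[< closure (interior [set y | f y = fs i y]) x >]]%SET.

Definition continuous_selection (R : realType) (T : topologicalType)
    (m : nat) (f : T -> R) (fs : 'I_m -> T -> R) : Prop :=
  [/\ continuous f,
      forall x, active_set f fs x != finset.set0 &
      forall i, exists x, i \in active_set f fs x].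

(* f is a CS function on M, with fs as a witnessing family. *)
Definition CS_function (R : realType) (n : nat) (M : smoothManifold R n)
    (m : nat) (f : M -> R) (fs : 'I_m -> M -> R) : Prop :=
  [/\ forall i, smooth_function (fs i),
      continuous_selection f fs,
      forall x, active_set f fs x = essentially_active_set f fs x &
      forall (x : M) (c : chart R n M), atlas c -> chart_dom c x ->
        affinely_independent (active_set f fs x)
          (fun j => gradient_in_chart c (fs j) x)].

(* Main.v *)
Require Import Defs.
From mathcomp Require Import all_boot all_order all_algebra all_fingroup.
From mathcomp Require Import ring lra.
From mathcomp Require Import boolp classical_sets functions reals topology.
From mathcomp Require Import normedtype landau derive.

(** Near a point p of M_J only functions with index in J can be active, so for
    a fixed j0 in J the set M_J is locally the common zero set of the
    f_j - f_j0, j in J \ {j0}, whose differentials at p are linearly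
    independent by affine independence of the gradients.

    The slice chart comes from straightening these functions one after the
    other: if the i-th partial derivative of g does not vanish, replacing the
    i-th coordinate by g is a local diffeomorphism, because it only moves points
    along one axis, where g is strictly monotone. Linear independence provides,
    at each step, an axis which has not been used yet and along which the next
    function has a nonzero derivative. Only one-variable calculus (intermediate
    and mean value theorems) is needed instead of the general inverse function
    theorem. *)

Set Implicit Arguments.
Unset Strict Implicit.
Unset Printing Implicit Defensive.

Import Order.TTheory GRing.Theory Num.Theory.
Import numFieldNormedType.Exports.

Local Open Scope classical_set_scope.
Local Open Scope ring_scope.

(** * Functions of class C^k *)

Section Littleo.
Context {R : realType} {V W : normedModType R}.

(** Taking [y = x] forces [f x = 0], so the bound says exactly that the zero map is the differential
    at [x]. Remainders of first-order approximations are handled this way. *)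
Lemma differentiable_littleo (f : V -> W) (x : V) :
  (forall e : R, 0 < e -> \forall y \near x, `|f y| <= e * `|y - x|) ->
  differentiable f x.
Proof.
move=> fo.
have fx0 : f x = 0.
  have /nbhs_singleton := fo 1 ltr01.
  by rewrite subrr normr0 mulr0 normr_le0 => /eqP.
have fE : f \o shift x = cst (f x) + (cst 0 : V -> W) +o_ 0 id.
  apply/eqaddoP => e e0; rewrite fx0.
  have := fo e e0; rewrite (near_shift 0 x) subr0 => H.
  rewrite near_simpl; near=> h.
  have : `|f (h + x)| <= e * `|h + x - x| by near: h; exact: H.
  by rewrite addrK !fctE add0r subr0.
have cst0 : (cst 0 : V -> W) = (\0 : {linear V -> W}) by [].
apply/diff_locallyP; rewrite cst0 in fE.
have c0 : continuous (\0 : V -> W) by move=> y; exact: cvg_cst.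
by rewrite (diff_unique c0 fE).
Unshelve. all: by end_near. Qed.

(** Write [g = f + (g - f)]: the second summand vanishes near [x], so it has differential zero
    there. *)
Lemma near_eq_differentiable (f g : V -> W) (x : V) :
  (\forall y \near x, f y = g y) -> differentiable f x -> differentiable g x.
Proof.
move=> fg df.
have -> : g = f + (g - f).
  by apply/funext => y; rewrite !fctE addrCA subrr addr0.
apply: differentiableD => //; apply: differentiable_littleo => e e0.
near=> y; have -> : (g - f) y = 0.
  by rewrite !fctE (near fg y) // subrr.
by rewrite normr0 mulr_ge0 // ltW.
Unshelve. all: by end_near. Qed.

End Littleo.

Lemma within_open_continuousP (T S : topologicalType) (U : set T) (f : T -> S) :
  open U ->
  {within U, continuous f} <-> (forall x, U x -> {for x, continuous f}).
Proof.
move=> oU; rewrite continuous_open_subspace //.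
by split=> [cf x Ux|cf x /set_mem]; [apply: cf; rewrite inE|exact: cf].
Qed.

Section Ck.
Context {R : realType} {n : nat}.
Implicit Types (U A : set 'rV[R]_n) (k : nat).

Section normed_target.
Context {W : normedModType R}.
Implicit Types f g : 'rV[R]_n -> W.

Lemma Ck_on_continuous k U g : open U -> Ck_on k U g ->
  forall y, U y -> {for y, continuous g}.
Proof.
move=> oU; case: k => [/within_open_continuousP|k [dg _] y Uy]; first exact.
exact/differentiable_continuous/dg.
Qed.

Lemma Ck_onW k U g : open U -> Ck_on k.+1 U g -> Ck_on k U g.
Proof.
move=> oU; elim: k g => [|k IH] g [dg Dg].
  apply/within_open_continuousP => // y Uy.
  exact/differentiable_continuous/dg.
by split=> // i; exact/IH/Dg.
Qed.

Lemma Ck_on_sub k U A g : A `<=` U -> Ck_on k U g -> Ck_on k A g.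
Proof.
move=> AU; elim: k g => [|k IH] g; first exact: continuous_subspaceW.
by case=> dg Dg; split=> [y /AU/dg//|i]; exact/IH/Dg.
Qed.

Lemma open_near_eq U f g y : open U -> (forall y, U y -> f y = g y) -> U y ->
  \forall z \near y, f z = g z.
Proof.
move=> oU fg Uy; have := open_nbhs_nbhs (conj oU Uy).
by apply: filterS => z; exact: fg.
Qed.

(** As [U] is open, agreement on [U] is agreement near each of its points and passes to partial
    derivatives. Derivatives can thus be replaced by formulas that hold on [U] only. *)
Lemma Ck_on_eq k U f g : open U -> (forall y, U y -> f y = g y) ->
  Ck_on k U f -> Ck_on k U g.
Proof.
move=> oU; elim: k f g => [|k IH] f g fg.
  move=> /within_open_continuousP cf; apply/within_open_continuousP => // y Uy.
  have fgy := open_near_eq oU fg Uy.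
  rewrite /prop_for /continuous_at -(fg y Uy).
  exact: cvg_trans (near_eq_cvg fgy) (cf oU y Uy).
move=> [df Df]; split=> [y Uy|i].
  exact: near_eq_differentiable (open_near_eq oU fg Uy) (df y Uy).
apply: IH (Df i) => y Uy.
exact/near_eq_derive/(open_near_eq oU fg Uy).
Qed.

Lemma Ck_on_cst k U (a : W) : Ck_on k U (cst a).
Proof.
elim: k a => [|k IH] a /=.
  exact/continuous_subspaceT/cst_continuous.
split=> [y _|i]; first exact: differentiable_cst.
by under eq_fun do rewrite derive_cst; exact: IH.
Qed.

Lemma Ck_onD k U f g : open U -> Ck_on k U f -> Ck_on k U g ->
  Ck_on k U (fun y => f y + g y).
Proof.
move=> oU; elim: k f g => [|k IH] f g.
  move=> /within_open_continuousP cf /within_open_continuousP cg.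
  apply/within_open_continuousP => // y Uy.
  exact: cvgD (cf oU y Uy) (cg oU y Uy).
move=> [df Df] [dg Dg]; split=> [y Uy|i].
  exact: differentiableD (df y Uy) (dg y Uy).
apply: Ck_on_eq (IH _ _ (Df i) (Dg i)) => // y Uy.
by rewrite deriveD //; apply: diff_derivable; [apply: df|apply: dg].
Qed.

Lemma Ck_on_sum k U m (F : 'I_m -> 'rV[R]_n -> W) : open U ->
  (forall l, Ck_on k U (F l)) -> Ck_on k U (fun y => \sum_l F l y).
Proof.
move=> oU; elim: m F => [|m IH] F CF.
  by under eq_fun do rewrite big_ord0; exact: Ck_on_cst.
under eq_fun do rewrite big_ord_recl.
by apply: Ck_onD => //; apply: IH.
Qed.

End normed_target.

Section real_valued.
Implicit Types f g : 'rV[R]_n -> R.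

Lemma Ck_onM k U f g : open U -> Ck_on k U f -> Ck_on k U g ->
  Ck_on k U (fun y => f y * g y).
Proof.
move=> oU; elim: k f g => [|k IH] f g.
  move=> /within_open_continuousP cf /within_open_continuousP cg.
  apply/within_open_continuousP => // y Uy.
  exact: cvgM (cf oU y Uy) (cg oU y Uy).
move=> Cf Cg; have [[df Df] [dg Dg]] := (Cf, Cg); split=> [y Uy|i].
  exact: differentiableM (df y Uy) (dg y Uy).
apply: (@Ck_on_eq _ _ _ (fun y => f y * 'D_(delta_mx 0 i) g y +
                                  g y * 'D_(delta_mx 0 i) f y)) => //.
  move=> y Uy.
  by rewrite deriveM //; apply: diff_derivable; [apply: df|apply: dg].
exact: Ck_onD oU (IH _ _ (Ck_onW oU Cf) (Dg i)) (IH _ _ (Ck_onW oU Cg) (Df i)).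
Qed.

Lemma Ck_onN k U f : open U -> Ck_on k U f -> Ck_on k U (fun y => - f y).
Proof.
move=> oU Cf; apply: Ck_on_eq (Ck_onM oU (Ck_on_cst k U (-1 : R)) Cf) => //.
by move=> y _; rewrite mulN1r.
Qed.

Lemma Ck_onB k U f g : open U -> Ck_on k U f -> Ck_on k U g ->
  Ck_on k U (fun y => f y - g y).
Proof. by move=> oU Cf Cg; apply: Ck_onD => //; exact: Ck_onN. Qed.

(** The partial derivatives of [1/f] are those of [f] times [-(1/f)^2], which is of class [k] by
    induction. *)
Lemma Ck_onV k U f : open U -> (forall y, U y -> f y != 0) ->
  Ck_on k U f -> Ck_on k U (fun y => (f y)^-1).
Proof.
move=> oU f0; elim: k => [|k IH].
  move=> /within_open_continuousP cf; apply/within_open_continuousP => // y Uy.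
  exact: cvgV (f0 y Uy) (cf oU y Uy).
move=> Cf; have [df Df] := Cf; split=> [y Uy|i].
  by apply: differentiableV; [exact: df|exact: f0].
have CV := IH (Ck_onW oU Cf).
apply: Ck_on_eq (Ck_onM oU (Ck_onN oU (Ck_onM oU CV CV)) (Df i)) => //.
move=> y Uy; rewrite deriveV ?f0 //; last exact/diff_derivable/df.
by rewrite -expr2 exprVn.
Qed.

End real_valued.

Lemma derive_coord (j : 'I_n) (y v : 'rV[R]_n) :
  'D_v (fun z : 'rV[R]_n => z 0 j) y = v 0 j.
Proof.
have /derive_mx/matrixP/(_ 0 j) := @derivable_id _ _ y v.
by rewrite derive_id mxE.
Qed.

Lemma Ck_on_coord k U (j : 'I_n) : Ck_on k U (fun y : 'rV[R]_n => y 0 j).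
Proof.
case: k => [|k]; first exact/continuous_subspaceT/coord_continuous.
split=> [y _|i]; first exact: differentiable_coord.
by under eq_fun do rewrite derive_coord; exact: Ck_on_cst.
Qed.

Lemma differentiable_row m (F : 'rV[R]_n -> 'rV[R]_m) y :
  (forall j, differentiable (fun y => F y 0 j) y) -> differentiable F y.
Proof.
move=> dF.
have -> : F = (\sum_j (fun y => F y 0 j *: (delta_mx 0 j : 'rV[R]_m))).
  by apply/funext => z; rewrite fct_sumE -row_sum_delta.
by apply: differentiable_sum => j; exact: differentiableZl.
Qed.

Lemma Ck_on_mxP k U m (F : 'rV[R]_n -> 'rV[R]_m) : open U ->
  Ck_on k U F <-> forall j, Ck_on k U (fun y => F y 0 j).
Proof.
move=> oU; elim: k F => [|k IH] F.
  split=> [/within_open_continuousP cF j|cF].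
    apply/within_open_continuousP => // y Uy.
    apply: (@continuous_comp _ _ _ F (fun z : 'rV[R]_m => z 0 j)).
      exact: cF.
    exact: coord_continuous.
  apply/within_open_continuousP => // y Uy.
  have {}cF j := (within_open_continuousP _ oU).1 (cF j) y Uy.
  (* The norm on rows is the maximum norm, so finitely many coordinate estimates bound it. *)
  apply/(@cvgrPdist_le _ _ _ _ (nbhs_filter y)) => e e0.
  have Fe : \forall z \near y, forall j, `|F y 0 j - F z 0 j| <= e.
    apply: (@filter_forall _ _ _ _ (nbhs_filter y)) => j.
    exact: ((@cvgrPdist_le _ _ _ _ (nbhs_filter y) _ _).1 (cF j)).
  apply: (filterS (F := nbhs y) _ Fe) => z {}Fe.
  rewrite [leLHS]/Num.Def.normr/= mx_normrE (bigmax_le _ (ltW e0)) //= => ij _.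
  by rewrite !mxE (ord1 ij.1).
have derE y i j : differentiable F y ->
    'D_(delta_mx 0 i) F y 0 j = 'D_(delta_mx 0 i) (fun y => F y 0 j) y.
  by move=> dF; rewrite derive_mx ?mxE //; exact: diff_derivable.
split=> [[dF DF] j|CF].
  split=> [y Uy|i].
    exact: differentiable_comp (dF y Uy) (differentiable_coord _ _ _).
  by apply: Ck_on_eq ((IH _).1 (DF i) j) => // y Uy; rewrite derE //; exact: dF.
have dF y : U y -> differentiable F y.
  by move=> Uy; apply: differentiable_row => j; apply: (CF j).1.
split=> // i; apply/IH => j.
by apply: Ck_on_eq ((CF j).2 i) => // y Uy; rewrite derE //; exact: dF.
Qed.

End Ck.

(** * The chain rule *)

Section Chain.
Context {R : realType} {n p : nat}.

Lemma derive_row (W : normedModType R) (f : 'rV[R]_n -> W) (x w : 'rV[R]_n) :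
  differentiable f x ->
  'D_w f x = \sum_j w 0 j *: 'D_(delta_mx 0 j) f x.
Proof.
move=> df; rewrite deriveE // {1}(row_sum_delta w) linear_sum.
by apply: eq_bigr => j _; rewrite linearZ deriveE.
Qed.

Lemma derive_comp_row (h : 'rV[R]_p -> 'rV[R]_n) (f : 'rV[R]_n -> R)
    (x v : 'rV[R]_p) :
  differentiable h x -> differentiable f (h x) ->
  'D_v (f \o h) x =
    \sum_j 'D_v (fun y => h y 0 j) x * 'D_(delta_mx 0 j) f (h x).
Proof.
move=> dh df; rewrite deriveE; last exact: differentiable_comp.
rewrite diff_comp // /= -deriveE // -deriveE // derive_row //.
rewrite derive_mx; last exact: diff_derivable.
by apply: eq_bigr => j _; rewrite mxE.
Qed.

(** By the chain rule each partial derivative of [f \o h] is a sum of products of partial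
    derivatives of [h] with compositions ['D f \o h], to which the induction hypothesis applies. *)
Lemma Ck_on_comp k (A : set 'rV[R]_p) (U : set 'rV[R]_n)
    (h : 'rV[R]_p -> 'rV[R]_n) (f : 'rV[R]_n -> R) :
  open A -> open U -> (forall y, A y -> U (h y)) ->
  Ck_on k A h -> Ck_on k U f -> Ck_on k A (f \o h).
Proof.
move=> oA oU AU; elim: k f => [|k IH] f.
  move=> /(within_open_continuousP _ oA) ch /(within_open_continuousP _ oU) cf.
  apply/(within_open_continuousP _ oA) => y Ay.
  exact: continuous_comp (ch y Ay) (cf (h y) (AU y Ay)).
move=> Ch Cf; have [[dh Dh] [df Df]] := (Ch, Cf); split=> [y Ay|i].
  exact: differentiable_comp (dh y Ay) (df (h y) (AU y Ay)).
have Chj := (Ck_on_mxP k.+1 h oA).1 Ch.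
apply: (@Ck_on_eq _ _ _ _ _ (fun y =>
  \sum_j 'D_(delta_mx 0 i) (fun y => h y 0 j) y *
         ('D_(delta_mx 0 j) f \o h) y)) => //.
  by move=> y Ay; rewrite derive_comp_row //; [apply: dh|apply/df/AU].
apply: Ck_on_sum => // j; apply: Ck_onM => //; first exact: (Chj j).2.
exact: IH (Ck_onW oA Ch) (Df j).
Qed.

Lemma Ck_on_comp_mx q k (A : set 'rV[R]_p) (U : set 'rV[R]_n)
    (h : 'rV[R]_p -> 'rV[R]_n) (f : 'rV[R]_n -> 'rV[R]_q) :
  open A -> open U -> (forall y, A y -> U (h y)) ->
  Ck_on k A h -> Ck_on k U f -> Ck_on k A (f \o h).
Proof.
move=> oA oU AU Ch /(Ck_on_mxP _ _ oU) Cf; apply/Ck_on_mxP => // j.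
exact: Ck_on_comp AU Ch (Cf j).
Qed.

End Chain.

(** * Replacing one coordinate by a function *)

Lemma cvg_lt_near (R : realType) (T : Type) (F : set_system T) (FF : Filter F)
    (f g : T -> R) (a b : R) :
  f @ F --> a -> g @ F --> b -> a < b -> \forall x \near F, f x < g x.
Proof.
move=> fa gb /midf_lt[am mb]; near=> x; apply: (@lt_trans _ _ ((a + b) / 2)).
  by near: x; exact: cvgr_lt fa _ am.
by near: x; exact: cvgr_gt gb _ mb.
Unshelve. all: by end_near. Qed.

Lemma ler_coord_norm (R : realType) (n : nat) (x : 'rV[R]_n) j :
  `|x 0 j| <= `|x|.
Proof.
rewrite [leRHS]/Num.Def.normr/= mx_normrE.
exact: (le_bigmax _ (fun ij => `|x ij.1 ij.2|) (0, j)).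
Qed.

(** Balls are convex: the point is the convex combination of the two ends with weight [l = c / t],
    the case [t = 0] being trivial. *)
Lemma ball_segment (R : realType) (V : normedModType R) (x y v : V)
    (q t c : R) :
  ball x q y -> ball x q (y + t *: v) -> 0 <= c <= t -> ball x q (y + c *: v).
Proof.
rewrite -ball_normE /= => xy xyt /andP[c0 ct].
have [t0|t0] := eqVneq t 0.
  have -> : c = 0 by apply/eqP; rewrite eq_le c0 -t0 ct.
  by rewrite scale0r addr0.
have tp : 0 < t by rewrite lt_neqAle eq_sym t0 (le_trans c0).
pose l := c / t.
have l0 : 0 <= l by rewrite divr_ge0 // ltW.
have l1 : 0 <= 1 - l by rewrite subr_ge0 ler_pdivrMr // mul1r.
have -> : x - (y + c *: v) = (1 - l) *: (x - y) + l *: (x - (y + t *: v)).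
  have -> : c = l * t by rewrite /l divfK.
  have E s : x - (y + s *: v) = x - y - s *: v by rewrite opprD addrA.
  by rewrite !E (scalerBr l (x - y)) addrA -scalerDl subrK scale1r scalerA.
apply: le_lt_trans (ler_normD _ _) _.
rewrite 2!normrZ (ger0_norm l0) (ger0_norm l1).
(* For [l != 0] the strict inequality comes from the term weighted by [l]; for [l = 0] it comes from
   the other end. *)
have [l00|l00] := eqVneq l 0.
  by rewrite l00 mul0r addr0 subr0 mul1r.
have : (1 - l) * `|x - y| <= (1 - l) * q by rewrite ler_wpM2l // ltW.
have : l * `|x - (y + t *: v)| < l * q.
  by rewrite ltr_pM2l // lt_neqAle eq_sym l00.
lra.
Qed.

Section SetCoord.
Context {R : realType} {n : nat}.
Context (i : 'I_n).
Local Notation e := (delta_mx 0 i : 'rV[R]_n).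

(** Written as a displacement of [y] along the axis [e], which is the form that arguments on
    segments parallel to that axis use. *)
Definition set_coord (u : 'rV[R]_n -> R) (y : 'rV[R]_n) : 'rV[R]_n :=
  y + (u y - y 0 i) *: e.

Lemma set_coordE u y : set_coord u y 0 i = u y.
Proof. by rewrite !mxE !eqxx mulr1 addrC subrK. Qed.

Lemma set_coord_neq u y j : j != i -> set_coord u y 0 j = y 0 j.
Proof. by move=> /negPf ji; rewrite !mxE ji andbF mulr0 addr0. Qed.

Lemma differentiable_set_coord u y :
  differentiable u y -> differentiable (set_coord u) y.
Proof.
move=> du; apply: differentiable_row => j.
have [->|ji] := eqVneq j i; first by under eq_fun do rewrite set_coordE.
by under eq_fun do rewrite set_coord_neq //; exact: differentiable_coord.
Qed.

Lemma derive_set_coord u y v : differentiable u y ->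
  'D_v (set_coord u) y = v + ('D_v u y - v 0 i) *: e.
Proof.
move=> du.
rewrite derive_mx; last exact/diff_derivable/differentiable_set_coord.
apply/rowP => j; rewrite !mxE; have [->|ji] := eqVneq j i.
  by under eq_fun do rewrite set_coordE; rewrite eqxx mulr1 addrC subrK.
under eq_fun do rewrite set_coord_neq //.
by rewrite derive_coord andbF mulr0 addr0.
Qed.

Lemma Ck_on_set_coord k (U : set 'rV[R]_n) u : open U ->
  Ck_on k U u -> Ck_on k U (set_coord u).
Proof.
move=> oU Cu; apply/Ck_on_mxP => // j.
have [->|ji] := eqVneq j i; first by under eq_fun do rewrite set_coordE.
by under eq_fun do rewrite set_coord_neq //; exact: Ck_on_coord.
Qed.

End SetCoord.

(** * Straightening one function along one axis *)

Section Straighten.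
Context {R : realType} {n : nat}.
Context (g : 'rV[R]_n -> R) (i : 'I_n) (x0 : 'rV[R]_n) (r s : R).
Let U : set 'rV[R]_n := ball x0 r.
Let e : 'rV[R]_n := delta_mx 0 i.
(* [s] carries the sign of the partial derivative. *)
Context (smooth_g : smooth_on U g)
  (g_gt0 : forall y, U y -> 0 < s * 'D_e g y).

Local Notation straighten := (set_coord i g).

(** The inverse is obtained by choice among preimages in [U]; the default [0] is taken only off the
    image of [U]. *)
Definition unstraighten (z : 'rV[R]_n) :=
  xget 0 [set y | U y /\ straighten y = z].

Let oU : open U. Proof. exact: ball_open. Qed.

Let dg y : U y -> differentiable g y.
Proof. exact: (smooth_g 1).1. Qed.

Let is_derive_line y c : U (y + c *: e) ->
  is_derive c 1 (fun c => g (y + c *: e)) ('D_e g (y + c *: e)).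
Proof.
move=> Uc.
have dZ := is_diff_scalel c e.
have dy := is_diff_cst y c.
have dl : differentiable (fun c : R => y + c *: e) c.
  exact: differentiableD (ex_diff (is_diff_def := dy))
    (ex_diff (is_diff_def := dZ)).
have dlE : 'd (fun c : R => y + c *: e) c 1 = e.
  rewrite -deriveE //; apply: lim_near_cst => //.
  near=> h; rewrite /= opprD addrACA subrr add0r -scalerBl addrK.
  rewrite /GRing.scale/= mulr1 -/(GRing.scale _ _) scalerA mulVf ?scale1r //.
  by near: h; exact: nbhs_dnbhs_neq.
have dgc := dg Uc.
split; first exact/diff_derivable/(differentiable_comp dl dgc).
rewrite deriveE; last exact: (differentiable_comp dl dgc).
by rewrite (diff_comp dl dgc) /= dlE deriveE.
Unshelve. all: by end_near. Qed.

Let line_continuous y t : U y -> U (y + t *: e) ->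
  {within `[0, t], continuous (fun c => g (y + c *: e))}.
Proof.
move=> Uy Ut; apply: derivable_within_continuous => c.
rewrite in_itv /= => ct; have [//] := is_derive_line (ball_segment Uy Ut ct).
Qed.

(** Mean value theorem on the segment from [y] to [y + t *: e], which stays in the ball [U] by
    convexity. *)
Lemma straighten_mono y t : U y -> U (y + t *: e) -> 0 < t ->
  s * g y < s * g (y + t *: e).
Proof.
move=> Uy Ut t0.
have [||c + E] := @MVT _ (fun c => g (y + c *: e))
  (fun c => 'D_e g (y + c *: e)) 0 t t0.
- move=> c; rewrite in_itv /= => /andP[c0 ct]; apply: is_derive_line.
  by apply: ball_segment Uy Ut _; rewrite !ltW.
- exact: line_continuous.
rewrite in_itv /= => /andP[c0 ct].
have Uc : U (y + c *: e) by apply: ball_segment Uy Ut _; rewrite !ltW.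
rewrite scale0r addr0 subr0 in E.
by rewrite -subr_gt0 -mulrBr E mulrA mulr_gt0 // g_gt0.
Qed.

(** Two points with the same image differ by a multiple of [e] and have the same value of [g];
    strict monotonicity along the axis makes them equal. *)
Lemma straighten_inj : {in U &, injective straighten}.
Proof.
move=> y z /set_mem Uy /set_mem Uz E.
have gE : g y = g z by rewrite -!(set_coordE i) E.
have zE : z = y + (z 0 i - y 0 i) *: e.
  move: E; rewrite /set_coord gE => /rowP E; apply/rowP => j.
  have := E j; rewrite !mxE; lra.
have yE : y = z + (y 0 i - z 0 i) *: e.
  by apply/rowP => j; have /rowP/(_ j) := zE; rewrite !mxE; lra.
have [lt|lt|eq_i] := ltgtP (y 0 i) (z 0 i).
- have := @straighten_mono y (z 0 i - y 0 i); rewrite -zE gE ltxx subr_gt0.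
  by move=> H; have := H Uy Uz lt.
- have := @straighten_mono z (y 0 i - z 0 i); rewrite -yE gE ltxx subr_gt0.
  by move=> H; have := H Uz Uy lt.
by rewrite zE eq_i subrr scale0r addr0.
Qed.

Lemma straightenK : {in U, cancel straighten unstraighten}.
Proof.
move=> y Uy; rewrite /unstraighten; case: xgetP => [z _ [Uz zE]|].
  by apply: straighten_inj => //; exact/mem_set.
by move=> /(_ y) /= []; split=> //; exact/set_mem.
Qed.

(** Gives both openness of the image and continuity of the inverse. On a short segment through [y]
    parallel to [e], the end values of [s * g] lie strictly on either side of [s * g y]. This
    persists for [z] near the image of [y], and the intermediate value theorem then yields a
    preimage of [z]. *)
Lemma straighten_open y eps : U y -> 0 < eps ->
  \forall z \near straighten y,
    exists y', [/\ U y', ball y eps y' & straighten y' = z].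
Proof.
move=> Uy eps0.
have /nbhs_ballP[q0 q00 q0U] := open_nbhs_nbhs (conj oU Uy).
pose q := Num.min q0 eps.
have q_gt0 : 0 < q by rewrite lt_min eps0 q00.
(* Chosen so that [d * |e| < q]; adding [1] makes the denominator visibly positive. *)
pose d := q / (2 * (`|e| + 1)).
have K0 : 0 < 2 * (`|e| + 1) by rewrite mulr_gt0 // ltr_wpDl.
have d0 : 0 < d by rewrite divr_gt0.
have dq t : `|t| <= d -> ball y q (y + t *: e).
  move=> td; rewrite -ball_normE /= opprD addNKr normrN normrZ.
  apply: (@le_lt_trans _ _ (d * `|e|)); first by rewrite ler_wpM2r.
  rewrite /d mulrAC ltr_pdivrMr // ltr_pM2l //.
  have := normr_ge0 e; lra.
have qU y' : ball y q y' -> U y' /\ ball y eps y'.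
  rewrite -ball_normE /= lt_min => /andP[yq0 ?]; split=> //.
  by apply: q0U; rewrite -ball_normE.
(* [p z] is [z] with its [i]-th coordinate replaced by [y 0 i - d]; the
   preimage of [z] is sought on the segment from [p z] to [p z + 2 d e]. *)
pose p (z : 'rV[R]_n) : 'rV[R]_n := z + (y 0 i - d - z 0 i) *: e.
have pc (z : 'rV[R]_n) : {for z, continuous p}.
  have dc : differentiable (fun z : 'rV[R]_n => y 0 i - d - z 0 i) z.
    exact: differentiableB (differentiable_cst _ _)
      (differentiable_coord _ _ _).
  apply: differentiable_continuous.
  exact: differentiableD (ex_diff (is_diff_def := is_diff_id z))
    (differentiableZl _ dc).
have p0 : p (straighten y) = y + (- d) *: e.
  rewrite /p set_coordE /set_coord; apply/rowP => j; rewrite !mxE; ring.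
have p1 : p (straighten y) + (2 * d) *: e = y + d *: e.
  rewrite p0; apply/rowP => j; rewrite !mxE; ring.
have p'c (z : 'rV[R]_n) :
    {for z, continuous (fun z : 'rV[R]_n => p z + (2 * d) *: e)}.
  exact: cvgD (pc z) (cvg_cst _).
have B0 : ball y q (y + (- d) *: e) by apply: dq; rewrite normrN gtr0_norm.
have B1 : ball y q (y + d *: e) by apply: dq; rewrite gtr0_norm.
have gc0 : {for y + (- d) *: e, continuous g}.
  by apply/differentiable_continuous/dg; have [] := qU _ B0.
have gc1 : {for y + d *: e, continuous g}.
  by apply/differentiable_continuous/dg; have [] := qU _ B1.
have m0 : s * g (y + (- d) *: e) < s * g y.
  have := @straighten_mono (y + (- d) *: e) d.
  rewrite -addrA -scalerDl addNr scale0r addr0; apply=> //.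
  by have [] := qU _ B0.
have m1 : s * g y < s * g (y + d *: e).
  by apply: straighten_mono => //; have [] := qU _ B1.
have N0 : \forall z \near straighten y, ball y q (p z).
  apply: pc; rewrite /= p0; apply: open_nbhs_nbhs.
  by split=> //; exact: ball_open.
have N1 : \forall z \near straighten y, ball y q (p z + (2 * d) *: e).
  apply: p'c; rewrite /= p1; apply: open_nbhs_nbhs.
  by split=> //; exact: ball_open.
have zc : (fun z : 'rV[R]_n => s * z 0 i) @ straighten y --> s * g y.
  have := @coord_continuous _ _ _ 0 i (straighten y).
  by rewrite /continuous_at set_coordE => zc; exact: cvgM (cvg_cst s) zc.
have pgc : (fun z => s * g (p z)) @ straighten y --> s * g (y + (- d) *: e).
  have gp : {for straighten y, continuous (g \o p)}.
    by apply: continuous_comp (pc _) _; rewrite p0.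
  rewrite /prop_for /continuous_at /= p0 in gp.
  exact: cvgM (cvg_cst s) gp.
have p'gc : (fun z => s * g (p z + (2 * d) *: e)) @ straighten y -->
    s * g (y + d *: e).
  have gp : {for straighten y, continuous
      (g \o (fun z : 'rV[R]_n => p z + (2 * d) *: e))}.
    by apply: continuous_comp (p'c _) _; rewrite p1.
  rewrite /prop_for /continuous_at /= p1 in gp.
  exact: cvgM (cvg_cst s) gp.
have N2 : \forall z \near straighten y, s * g (p z) < s * (z : 'rV[R]_n) 0 i.
  exact: cvg_lt_near pgc zc m0.
have N3 : \forall z \near straighten y,
    s * (z : 'rV[R]_n) 0 i < s * g (p z + (2 * d) *: e).
  exact: cvg_lt_near zc p'gc m1.
apply: filterS (filterI (filterI N0 N1) (filterI N2 N3)).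
move=> z [[Bp Bp'] [L2 L3]].
have [Up _] := qU _ Bp.
have [Up' _] := qU _ Bp'.
have d2 : 0 <= 2 * d by rewrite mulr_ge0 // ltW.
have [|c] := @IVT R (fun c => g (p z + c *: e)) _ _ (z 0 i) d2
  (line_continuous Up Up').
  (* The sign of [s] decides which end value of [g] is the smaller one; [s = 0] contradicts the
     strict inequality [L2]. *)
  rewrite scale0r addr0; have [s0|s0|s0] := ltgtP s 0.
  - have A : z 0 i < g (p z) by rewrite -(ltr_nM2l s0).
    have B : g (p z + (2 * d) *: e) < z 0 i by rewrite -(ltr_nM2l s0).
    by rewrite ge_min le_max (ltW A) (ltW B) !orbT.
  - have A : g (p z) < z 0 i by rewrite -(ltr_pM2l s0).
    have B : z 0 i < g (p z + (2 * d) *: e) by rewrite -(ltr_pM2l s0).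
    by rewrite ge_min le_max (ltW A) (ltW B) !orbT.
  - by move: L2; rewrite s0 !mul0r ltxx.
rewrite in_itv /= => cd gc.
exists (p z + c *: e).
have [Uc Bc] := qU _ (ball_segment Bp Bp' cd).
split => //.
rewrite /set_coord gc /p; apply/rowP => j; rewrite !mxE !eqxx /=; ring.
Qed.

(** * Smoothness of the inverse *)

Let V := straighten @` U.

Lemma open_straighten : open V.
Proof.
rewrite openE => _ [y Uy <-].
apply: filterS (straighten_open Uy ltr01) => z [y' [Uy' _ <-]].
by exists y'.
Qed.

Lemma unstraightenK z :
  V z -> U (unstraighten z) /\ straighten (unstraighten z) = z.
Proof. by move=> [y Uy <-]; rewrite straightenK //; exact/mem_set. Qed.

Lemma unstraighten_continuous z : V z -> {for z, continuous unstraighten}.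
Proof.
move=> [y Uy <-]; apply/(@cvgrPdist_lt _ _ _ _ (nbhs_filter _)) => eps eps0.
rewrite straightenK ?inE //.
apply: filterS (straighten_open Uy eps0) => z' [y' [Uy' yy' <-]].
by rewrite straightenK ?inE //; move: yy'; rewrite -ball_normE.
Qed.

Let h z := unstraighten z 0 i.

(** The inverse, too, moves points along [e] only, so its regularity reduces to that of the scalar
    function [h]. *)
Lemma unstraightenE z : V z -> unstraighten z = set_coord i h z.
Proof.
move=> [y Uy <-]; rewrite {2}/set_coord /h straightenK ?inE // set_coordE.
by rewrite /set_coord -addrA -scalerDl addrA subrK subrr scale0r addr0.
Qed.

Lemma g_unstraighten z : V z -> g (unstraighten z) = z 0 i.
Proof. by move=> /unstraightenK[_ E]; rewrite -[in RHS]E set_coordE. Qed.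

(** Up to the factor [- a^-1], the error of the affine approximation of [h] is the Taylor remainder
    of [g] at [y]. That is small relative to [v], and [v] is bounded by a multiple of [w]. *)
Lemma differentiable_unstraighten_coord z : V z -> differentiable h z.
Proof.
move=> [y Uy <-]; set z0 := straighten y.
have Vz0 : V z0 by exists y.
have Psiz0 : unstraighten z0 = y by rewrite straightenK ?inE.
set a := 'D_e g y.
have a0 : a != 0.
  by apply/eqP => a0; have := g_gt0 Uy; rewrite -/a a0 mulr0 ltxx.
(* The first-order approximation of [h] at [z0], found as follows. Put
   [v = unstraighten z - y] and [w = z - z0]; these differ by a multiple [t] of
   [e], so [w 0 i = g (y + v) - g y = 'd g y w + t * a + o(v)] gives [t]. *)
pose A (z : 'rV[R]_n) := y 0 i + (z 0 i - z0 0 i) +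
  a^-1 * ((z 0 i - z0 0 i) - 'd g y (z - z0)).
have dA : differentiable A z0.
  have dB : differentiable (fun z : 'rV[R]_n => z 0 i - z0 0 i) z0.
    exact: differentiableB (differentiable_coord _ _ _)
      (differentiable_cst _ _).
  have dsub : differentiable (fun z : 'rV[R]_n => z - z0) z0.
    exact: differentiableB (ex_diff (is_diff_def := is_diff_id z0))
      (differentiable_cst _ _).
  have dL : differentiable ('d g y \o (fun z : 'rV[R]_n => z - z0)) z0.
    apply: (differentiable_comp dsub); apply: linear_differentiable.
    exact/diff_continuous/dg.
  exact: differentiableD (differentiableD (differentiable_cst _ _) dB)
    (differentiableM (differentiable_cst _ _) (differentiableB dB dL)).
have -> : h = A + (h - A).
  by apply/funext => z'; rewrite !fctE addrCA subrr addr0.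
apply: differentiableD => //; apply: differentiable_littleo => eps eps0.
have [k k0 kP] := linear_lipschitz (diff_continuous (dg Uy)).
pose K := `|e| * `|a^-1|.
pose C := 1 + K * (1 + k).
have K0 : 0 <= K by rewrite mulr_ge0.
have C0 : 0 < C.
  have : 0 <= K * (1 + k) by rewrite mulr_ge0 // addr_ge0 // ltW.
  by rewrite /C; lra.
(* The first bound gives [K * e1 <= 1 / 2], which lets a term in [|v|] be absorbed; the second
   brings the final error below [eps * |w|]. *)
pose e1 := Num.min (1 / (2 * (K + 1))) (eps / (2 * C * (`|a^-1| + 1))).
have D0 : 0 < 2 * C * (`|a^-1| + 1) by rewrite mulr_gt0 ?ltr_wpDl // mulr_gt0.
have D1 : 0 < 2 * (K + 1) by rewrite mulr_gt0 // ltr_wpDl.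
have e10 : 0 < e1 by rewrite lt_min !divr_gt0.
have Ke1 : K * e1 <= 1 / 2.
  have : e1 <= 1 / (2 * (K + 1)) by rewrite ge_min lexx.
  by rewrite ler_pdivlMr //; move: e10 K0; nra.
have Ce1 : `|a^-1| * e1 * (2 * C) <= eps.
  have : e1 <= eps / (2 * C * (`|a^-1| + 1)) by rewrite ge_min lexx orbT.
  rewrite ler_pdivlMr //.
  have : 0 < C * e1 by rewrite mulr_gt0.
  by have := normr_ge0 a^-1; nra.
have rem : \forall y' \near y,
    `|g y' - g y - 'd g y (y' - y)| <= e1 * `|y' - y|.
  have /eqaddoP/(_ e1 e10) := diff_locally (dg Uy).
  rewrite (near_shift 0 y) subr0; apply: filterS => v.
  by rewrite /= addrK !fctE /= opprD addrA.
have rem' : \forall z \near z0,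
    `|g (unstraighten z) - g y - 'd g y (unstraighten z - y)| <=
    e1 * `|unstraighten z - y|.
  have cP := unstraighten_continuous Vz0.
  by rewrite /prop_for /continuous_at Psiz0 in cP; exact: (cP _ rem).
have nV : \forall z \near z0, V z.
  by apply: open_nbhs_nbhs; split=> //; exact: open_straighten.
apply: filterS (filterI nV rem') => {}z [Vz].
have gy : g y = z0 0 i by rewrite -Psiz0 g_unstraighten.
rewrite g_unstraighten // gy.
set v := unstraighten z - y; set w := z - z0.
set t := v 0 i - w 0 i.
have vE : v = w + t *: e.
  rewrite /t /v /w unstraightenE // -Psiz0 (unstraightenE Vz0).
  by apply/rowP => j; rewrite !mxE !eqxx /=; ring.
have dvE : 'd g y v = 'd g y w + t * a.
  have -> : a = 'd g y e by rewrite /a deriveE //; exact: dg.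
  by rewrite vE linearD linearZ.
have wi : z 0 i - z0 0 i = w 0 i by rewrite !mxE.
rewrite wi; set rr := w 0 i - _ => Hr.
have tE : t = a^-1 * (w 0 i - 'd g y w - rr).
  by rewrite /rr dvE; field.
have -> : (h - A) z = - (a^-1 * rr).
  have -> : (h - A) z = h z - A z by [].
  rewrite /A wi -/w.
  have -> : h z = t + w 0 i + y 0 i by rewrite /t /v /h !mxE; ring.
  by rewrite tE; ring.
rewrite normrN normrM.
(* The formula for [t] bounds [|v|] by [C * |w| + K * e1 * |v|], and the last term is at most half
   of [|v|]. *)
have nv : `|v| <= 2 * C * `|w|.
  have : `|v| <= `|w| + K * (`|w| + k * `|w| + e1 * `|v|).
    rewrite {1}vE; apply: le_trans (ler_normD _ _) _; rewrite lerD2l normrZ.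
    rewrite /K tE normrM mulrC -!mulrA ler_wpM2l // ler_wpM2l //.
    apply: le_trans (ler_normB _ _) _; apply: lerD => //.
    apply: le_trans (ler_normB _ _) _; apply: lerD => //; exact: ler_coord_norm.
  have : K * e1 * `|v| <= 1 / 2 * `|v| by rewrite ler_wpM2r.
  rewrite /C; lra.
apply: (@le_trans _ _ (`|a^-1| * (e1 * `|v|))); first by rewrite ler_wpM2l.
apply: (@le_trans _ _ (`|a^-1| * e1 * (2 * C) * `|w|)); last first.
  by rewrite ler_wpM2r.
rewrite -!mulrA ler_wpM2l // ler_wpM2l //; first exact: ltW.
by rewrite mulrA.
Qed.

(** Differentiate the identity [g (set_coord i h z) = z 0 i] on [V] and solve for the partial
    derivative of [h]. *)
Lemma derive_unstraighten_coord z l : V z ->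
  'D_(delta_mx 0 l) h z = (delta_mx 0 l : 'rV[R]_n) 0 i +
    ((delta_mx 0 l : 'rV[R]_n) 0 i - 'D_(delta_mx 0 l) g (unstraighten z)) *
    ('D_e g (unstraighten z))^-1.
Proof.
move=> Vz; set el : 'rV[R]_n := delta_mx 0 l.
have [Uz _] := unstraightenK Vz.
have dh := differentiable_unstraighten_coord Vz.
have dsc := differentiable_set_coord i dh.
have oV := open_straighten.
have a0 : 'D_e g (unstraighten z) != 0.
  by apply/eqP => a0; have := g_gt0 Uz; rewrite a0 mulr0 ltxx.
have dgP : differentiable g (set_coord i h z).
  by rewrite -unstraightenE //; exact: dg.
have : 'D_el (g \o set_coord i h) z = el 0 i.
  rewrite -(derive_coord i z); apply: near_eq_derive.
  apply: open_near_eq oV _ Vz => z' Vz'.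
  by rewrite /= -unstraightenE // g_unstraighten.
rewrite deriveE; last exact: differentiable_comp dsc dgP.
rewrite (diff_comp dsc dgP) /= -(deriveE _ dsc) derive_set_coord //.
rewrite linearD linearZ /= -!(deriveE _ dgP) -unstraightenE //.
rewrite /GRing.scale /= => E.
have -> : el 0 i - 'D_el g (unstraighten z) =
    ('D_el h z - el 0 i) * 'D_e g (unstraighten z) by lra.
by rewrite mulfK // addrC subrK.
Qed.

(** Bootstrapping: if [h] is of class [k], so is [unstraighten], hence so are the partial
    derivatives of [h] by their formula, and [h] is of class [k + 1]. *)
Lemma smooth_unstraighten : smooth_on V unstraighten.
Proof.
have oV := open_straighten.
have Ch k : Ck_on k V h.
  elim: k => [|k IH].
    apply/(within_open_continuousP _ oV) => z Vz.
    exact/differentiable_continuous/differentiable_unstraighten_coord.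
  split=> [z Vz|l]; first exact: differentiable_unstraighten_coord.
  have CP : Ck_on k V unstraighten.
    apply: Ck_on_eq (Ck_on_set_coord i oV IH) => // z Vz.
    by rewrite -unstraightenE.
  have CD j : Ck_on k V ('D_(delta_mx 0 j) g \o unstraighten).
    by apply: Ck_on_comp CP ((smooth_g k.+1).2 j) => // z /unstraightenK[].
  have CV : Ck_on k V (fun z => ('D_e g (unstraighten z))^-1).
    apply: (Ck_onV oV _ (CD i)) => z /unstraightenK[Uz _].
    by apply/eqP => /= a0; have := g_gt0 Uz; rewrite a0 mulr0 ltxx.
  have cst c : Ck_on k V (fun=> c : R) by exact: Ck_on_cst.
  apply: Ck_on_eq oV _ (Ck_onD oV (cst _)
    (Ck_onM oV (Ck_onB oV (cst _) (CD l)) CV)) => z Vz.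
  by rewrite derive_unstraighten_coord.
move=> k; apply: Ck_on_eq (Ck_on_set_coord i oV (Ch k)) => // z Vz.
by rewrite -unstraightenE.
Qed.

End Straighten.

(** * Local diffeomorphisms of R^n *)

Section LocalDiffeo.
Context {R : realType} {n : nat}.
Implicit Types (U A W : set 'rV[R]_n) (Phi Psi : 'rV[R]_n -> 'rV[R]_n).

(** The inverse is explicit data, since the inverse map of a composed chart is built from it. *)
Definition local_diffeo U Phi Psi : Prop :=
  [/\ open U, open (Phi @` U), smooth_on U Phi, smooth_on (Phi @` U) Psi &
      forall y, U y -> Psi (Phi y) = y].

Lemma local_diffeo_sub A U Phi Psi : open A -> A `<=` U ->
  local_diffeo U Phi Psi -> local_diffeo A Phi Psi.
Proof.
move=> oA AU [oU oV sPhi sPsi PhiK]; split=> //.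
- have -> : Phi @` A = Phi @` U `&` Psi @^-1` A.
    apply/seteqP; split=> [_ [y Ay <-]|_ [[y Uy <-] /=]].
      by split; [exists y => //; exact: AU|rewrite /= PhiK //; exact: AU].
    by rewrite PhiK // => Ay; exists y.
  apply: (continuous_inP _ oV).1 => // z /set_mem Vz.
  exact: (Ck_on_continuous oV (sPsi 0)).
- by move=> k; exact: Ck_on_sub (sPhi k).
- move=> k; apply: Ck_on_sub (sPsi k) => _ [y Ay <-].
  by exists y => //; exact: AU.
- by move=> y /AU; exact: PhiK.
Qed.

Lemma local_diffeo_comp U Phi Psi U' Phi' Psi' :
  local_diffeo U Phi Psi -> local_diffeo U' Phi' Psi' ->
  local_diffeo (U `&` Phi @^-1` U') (Phi' \o Phi) (Psi \o Psi').
Proof.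
move=> D D'; have [oU oV sPhi _ _] := D; have [oU' _ sPhi' _ PhiK'] := D'.
have oA : open (U `&` Phi @^-1` U').
  apply: (continuous_inP _ oU).1 => // y /set_mem Uy.
  exact: (Ck_on_continuous oU (sPhi 0)).
have {}D := local_diffeo_sub oA (@subIsetl _ _ _) D.
have [_ oB sPhiA sPsiB PhiK] := D.
have BU' : Phi @` (U `&` Phi @^-1` U') `<=` U' by move=> _ [y [_ ?] <-].
have [_ oC _ sPsiC _] := local_diffeo_sub oB BU' D'.
split=> //.
- by rewrite image_comp in oC.
- move=> k; apply: Ck_on_comp_mx (sPhiA k) (sPhi' k) => //.
  by move=> y [].
- move=> k; rewrite -image_comp; apply: Ck_on_comp_mx (sPsiC k) (sPsiB k) => //.
  by move=> _ [z Bz <-]; rewrite PhiK' //; exact: BU'.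
- by move=> y [Uy U'y] /=; rewrite PhiK' // PhiK.
Qed.

Lemma local_diffeo_id : local_diffeo setT id id.
Proof.
have sid : smooth_on setT (@id 'rV[R]_n).
  by move=> k; apply/(Ck_on_mxP _ _ openT) => j; exact: Ck_on_coord.
have imT : (@id 'rV[R]_n) @` setT = setT by exact: image_id.
by split; rewrite ?imT //; exact: openT.
Qed.

Lemma local_diffeo_col_perm (s : 'S_n) :
  local_diffeo setT (fun y => col_perm s y) (fun y => col_perm s^-1%g y).
Proof.
have sm (t : 'S_n) : smooth_on setT (fun y : 'rV[R]_n => col_perm t y).
  move=> k; apply/(Ck_on_mxP _ _ openT) => j.
  by under eq_fun do rewrite mxE; exact: Ck_on_coord.
have K (t : 'S_n) : cancel (@col_perm R 1 n t) (@col_perm R 1 n t^-1%g).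
  by move=> y; rewrite -col_permM mulVg col_perm1.
have imT : (fun y : 'rV[R]_n => col_perm s y) @` setT = setT.
  apply/seteqP; split=> // y _; exists (col_perm s^-1%g y) => //.
  by have := K s^-1%g y; rewrite invgK.
split; rewrite ?imT; [exact: openT|exact: openT|exact: sm|exact: sm|].
by move=> y _; exact: K.
Qed.

(** By continuity the partial derivative keeps its sign on some ball around [y], and on a ball the
    straightening results apply. *)
Lemma local_diffeo_set_coord W (g : 'rV[R]_n -> R) (i : 'I_n) (y : 'rV[R]_n) :
  open W -> W y -> smooth_on W g -> 'D_(delta_mx 0 i) g y != 0 ->
  exists U Psi, [/\ U y, U `<=` W & local_diffeo U (set_coord i g) Psi].
Proof.
move=> oW Wy sg a0; set a := 'D_(delta_mx 0 i) g y in a0.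
pose s := Num.sg a.
have cD : {for y, continuous ('D_(delta_mx 0 i) g)}.
  exact: (@Ck_on_continuous _ _ _ 0 _ _ oW ((sg 1).2 i) y Wy).
have sD : \forall y' \near y, 0 < s * 'D_(delta_mx 0 i) g y'.
  have sc : (fun y' => s * 'D_(delta_mx 0 i) g y') @ y --> s * a.
    exact: cvgM (cvg_cst s) cD.
  have sa0 : 0 < s * a by rewrite -normrEsg normr_gt0.
  exact: cvgr_gt sc _ sa0.
have : nbhs y (W `&` [set z | 0 < s * 'D_(delta_mx 0 i) g z]).
  by apply: filterI => //; exact: open_nbhs_nbhs.
move=> /nbhs_ballP[r r0 rP].
have sgU : smooth_on (ball y r) g.
  by move=> k; apply: Ck_on_sub (sg k) => z /rP[].
have gt0 z : ball y r z -> 0 < s * 'D_(delta_mx 0 i) g z by move=> /rP[].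
exists (ball y r), (unstraighten g i y r); split.
- exact: ballxx.
- by move=> z /rP[].
split.
- exact: ball_open.
- exact: open_straighten sgU gt0.
- by move=> k; apply: Ck_on_set_coord; [exact: ball_open|exact: sgU].
- exact: smooth_unstraighten sgU gt0.
- by move=> z Uz; apply: (straightenK sgU gt0); exact/mem_set.
Qed.

(* [B] is the set of coordinates that have been straightened, and [tau i] is the
   index of the function which has become the [i]-th coordinate. *)
Lemma straighten_independent (I : choiceType) (x0 : I) (f : I -> 'rV[R]_n -> R)
    (s : seq I) W (y : 'rV[R]_n) :
  open W -> W y -> uniq s -> {in s, forall j, smooth_on W (f j)} ->
  (forall a : I -> R,
    (forall l, \sum_(j <- s) a j * 'D_(delta_mx 0 l) (f j) y = 0) ->
    {in s, forall j, a j = 0}) ->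
  exists (U : set 'rV[R]_n) Phi Psi (B : {set 'I_n}) (tau : 'I_n -> I),
    [/\ local_diffeo U Phi Psi, U y, U `<=` W,
        perm_eq s [seq tau i | i <- enum B] &
        forall i z, i \in B -> U z -> Phi z 0 i = f (tau i) z].
Proof.
move=> oW Wy; elim: s => [|k s IH] us sf indep.
  exists W, id, id, finset.set0, (fun=> x0); split=> //.
  - exact: local_diffeo_sub local_diffeo_id.
  - by rewrite enum_set0.
  - by move=> i z; rewrite finset.in_set0.
move: us => /= /andP[ks us].
have [||U [Phi [Psi [B [tau [D Uy UW Bs BP]]]]]] := IH us.
- by move=> j js; apply: sf; rewrite inE js orbT.
- move=> a a0 j js.
  (* A relation among the functions in [s] extends to [k :: s] with coefficient [0] at [k]. *)
  have := indep (fun j => if j == k then 0 else a j).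
  have jk : j != k by apply: contraNneq ks => <-.
  move=> /(_ _ j); rewrite inE js orbT (negPf jk); apply=> // l.
  rewrite big_cons eqxx mul0r add0r -[RHS](a0 l); apply: eq_big_seq => j' j's.
  by rewrite ifN //; apply: contraNneq ks => <-.
have [oU oV sPhi sPsi PhiK] := D.
pose g := f k \o Psi.
have sg : smooth_on (Phi @` U) g.
  move=> q; apply: (Ck_on_comp oV oW) (sPsi q) (sf k _ q); last exact: mem_head.
  by move=> _ [z Uz <-]; rewrite PhiK //; exact: UW.
have VPhi : (Phi @` U) (Phi y) by exists y.
have [i iB gi] : exists2 i, i \notin B & 'D_(delta_mx 0 i) g (Phi y) != 0.
  apply/not_exists2P => gB.
  have {}gB i : i \notin B -> 'D_(delta_mx 0 i) g (Phi y) = 0.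
    by move=> iB; have [//|/negP] := gB i; rewrite negbK => /eqP.
  have tau_inj : {in B &, injective tau}.
    by apply/dinjectiveP; rewrite /dinjectiveb -(perm_uniq Bs).
  (* The coefficients come from the chain rule for [f k = g \o Phi] near [y]: only axes in [B]
     contribute, and there the coordinates of [Phi] are the [f (tau i)]. *)
  pose a j := if j == k then -1 else
    if [pick i in B | tau i == j] is Some i then 'D_(delta_mx 0 i) g (Phi y)
    else 0.
  have tauk i : i \in B -> tau i != k.
    move=> iB; apply: contraNneq ks => <-.
    by rewrite (perm_mem Bs) map_f // mem_enum.
  have atau i : i \in B -> a (tau i) = 'D_(delta_mx 0 i) g (Phi y).
    move=> iB; rewrite /a ifN ?tauk //; case: pickP => [i' /andP[i'B /eqP]|].
      by move=> /tau_inj ->.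
    by move=> /(_ i); rewrite iB eqxx.
  have : a k = 0.
    apply: (indep a _ k); last exact: mem_head.
    move=> l; rewrite big_cons {1}/a eqxx mulN1r (perm_big _ Bs) /=.
    rewrite big_map big_enum /=.
    apply/eqP; rewrite addrC subr_eq0 eq_sym; apply/eqP.
    have -> : 'D_(delta_mx 0 l) (f k) y = 'D_(delta_mx 0 l) (g \o Phi) y.
      apply/near_eq_derive/(open_near_eq oU _ Uy) => z Uz.
      by rewrite /g /= PhiK.
    rewrite derive_comp_row; [|exact: (sPhi 1).1|exact: (sg 1).1].
    rewrite [RHS]big_mkcond; apply: eq_bigr => i _.
    case: ifP => iB; last by rewrite gB ?iB // mulr0.
    rewrite atau // mulrC; congr (_ * _).
    by apply/near_eq_derive/(open_near_eq oU _ Uy) => z Uz; exact: BP.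
  by rewrite /a eqxx => /eqP; rewrite oppr_eq0 oner_eq0.
have [U' [Psi' [U'y U'V D']]] := local_diffeo_set_coord oV VPhi sg gi.
exists (U `&` Phi @^-1` U'), (set_coord i g \o Phi), (Psi \o Psi'),
  (i |: B)%SET, (fun i' => if i' == i then k else tau i'); split.
- exact: local_diffeo_comp.
- by [].
- by move=> z [/UW].
- have enumB : perm_eq (i :: enum B) (enum (i |: B)%SET).
    apply: uniq_perm => [||i']; rewrite /= ?mem_enum ?iB ?enum_uniq //.
    by rewrite inE !mem_enum finset.in_setU1.
  rewrite (perm_trans _ (perm_map _ enumB)) //= eqxx perm_cons.
  move: Bs; congr perm_eq; apply/eq_in_map => i'; rewrite mem_enum => i'B.
  by rewrite ifN //; apply: contraNneq iB => <-.
- move=> i' z; rewrite finset.in_setU1 => /orP[/eqP ->|i'B] [Uz _].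
    by rewrite eqxx /= set_coordE /g /= PhiK.
  have ii' : i' != i by apply: contraNneq iB => <-.
  by rewrite (negPf ii') /= set_coord_neq // BP.
Qed.

End LocalDiffeo.

(** * Slice charts *)

(** List [A] followed by its complement, and [B] followed by its complement; matching equal
    positions gives the permutation. *)
Lemma perm_of_eq_card (T : finType) (A B : {set T}) :
  #|A| = #|B| -> exists s : {perm T}, forall x, (s x \in B) = (x \in A).
Proof.
move=> AB.
have AB' : #|~: A| = #|~: B|.
  by apply/eqP; rewrite -(eqn_add2l #|A|) cardsC AB cardsC.
pose t1 := enum A ++ enum (~: A); pose t2 := enum B ++ enum (~: B).
have mem_t (C : {set T}) x : x \in enum C ++ enum (~: C).
  by rewrite mem_cat !mem_enum finset.in_setC orbN.
have uniq_t (C : {set T}) : uniq (enum C ++ enum (~: C)).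
  rewrite cat_uniq !enum_uniq andbT /=; apply/hasPn => x.
  by rewrite !mem_enum finset.in_setC.
have u2 : uniq t2 := uniq_t B.
have sz : size t1 = size t2 by rewrite !size_cat -!cardE AB AB'.
pose h x := nth x t2 (index x t1).
have ht x : (index x t1 < size t2)%N by rewrite -sz index_mem mem_t.
have h_inj : injective h.
  move=> x y; rewrite /h (set_nth_default x y) // => /eqP.
  rewrite nth_uniq // => /eqP E.
  by rewrite -(nth_index x (mem_t A x)) -/t1 E nth_index // mem_t.
exists (perm h_inj) => x; rewrite permE /h /t1 /t2 nth_cat index_cat mem_enum.
rewrite -!cardE -AB; have [xA|xA] := boolP (x \in A).
  have lt_x : (index x (enum A) < #|A|)%N by rewrite cardE index_mem mem_enum.
  by rewrite lt_x -mem_enum mem_nth // -cardE -AB.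
rewrite ltnNge leq_addr /= addKn; apply/negbTE.
rewrite -finset.in_setC -mem_enum mem_nth // -cardE -AB' cardE index_mem.
by rewrite mem_enum finset.in_setC.
Qed.

Section Charts.
Context {R : realType} {n : nat}.

Lemma chart_image_open (T : topologicalType) (c : chart R n T) (O : set T) :
  open O -> open (c @` (chart_dom c `&` O)).
Proof.
move=> oO.
have -> : c @` (chart_dom c `&` O) =
    c @` chart_dom c `&` chart_inv c @^-1` O.
  apply/seteqP; split=> [_ [x [cx Ox] <-]|_ [[x cx <-]]] /=.
    by split; [exists x|rewrite chart_mapK ?inE].
  by rewrite chart_mapK ?inE // => Ox; exists x.
apply: (continuous_inP _ (@chart_img_open _ _ _ c)).1 => // y /set_mem.
apply: (within_open_continuousP _ (@chart_img_open _ _ _ c)).1.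
exact: chart_inv_continuous.
Qed.

(** * Composing a chart with a local diffeomorphism *)

Section Comp.
Context (T : topologicalType) (c : chart R n T).
Context (U : set 'rV[R]_n) (Phi Psi : 'rV[R]_n -> 'rV[R]_n).
Context (D : local_diffeo U Phi Psi) (Uc : U `<=` c @` chart_dom c).

Let dom : set T := chart_dom c `&` c @^-1` U.

Let dom_open : open dom.
Proof.
have [oU _ _ _ _] := D.
apply: (continuous_inP _ (@chart_dom_open _ _ _ c)).1 => // x /set_mem.
apply: (within_open_continuousP _ (@chart_dom_open _ _ _ c)).1.
exact: chart_map_continuous.
Qed.

Let imageE : (Phi \o c) @` dom = Phi @` U.
Proof.
apply/seteqP; split=> [_ [x [_ Ux] <-]|_ [y Uy <-]]; first by exists (c x).
by have [x cx xy] := Uc Uy; exists x; [split; rewrite //= xy|rewrite /= xy].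
Qed.

Let img_open : open ((Phi \o c) @` dom).
Proof. by rewrite imageE; case: D. Qed.

Let mapK : {in dom, cancel (Phi \o c) (chart_inv c \o Psi)}.
Proof.
move=> x /set_mem [cx Ux] /=; have [_ _ _ _ PhiK] := D.
by rewrite PhiK // chart_mapK ?inE.
Qed.

Let map_continuous : {within dom, continuous (Phi \o c)}.
Proof.
have [oU _ sPhi _ _] := D.
apply/(within_open_continuousP _ dom_open) => x [cx Ux].
apply: continuous_comp; last exact: (Ck_on_continuous oU (sPhi 0)).
apply: (within_open_continuousP _ (@chart_dom_open _ _ _ c)).1 => //.
exact: chart_map_continuous.
Qed.

Let inv_continuous :
  {within (Phi \o c) @` dom, continuous (chart_inv c \o Psi)}.
Proof.
have [oU oV _ sPsi PhiK] := D.
apply/(within_open_continuousP _ img_open); rewrite imageE => z Vz.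
apply: continuous_comp; first exact: (Ck_on_continuous oV (sPsi 0)).
apply: (within_open_continuousP _ (@chart_img_open _ _ _ c)).1.
  exact: chart_inv_continuous.
by case: Vz => y Uy <-; rewrite PhiK //; exact: Uc.
Qed.

Definition chart_comp : chart R n T :=
  Chart dom_open img_open mapK map_continuous inv_continuous.

End Comp.

(** The transitions with [d] are those between [c] and [d], precomposed with [Psi] in one direction
    and followed by [Phi] in the other. *)
Lemma smooth_chart_comp (M : smoothManifold R n) (c : chart R n M)
    (U : set 'rV[R]_n) (Phi Psi : 'rV[R]_n -> 'rV[R]_n)
    (D : local_diffeo U Phi Psi) (Uc : U `<=` c @` chart_dom c) :
  atlas c -> smooth_chart (chart_comp D Uc).
Proof.
move=> ac d ad; set c' := chart_comp D Uc.
have [oU oV sPhi sPsi PhiK] := D.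
have ocd : open (c @` (chart_dom c `&` chart_dom d)).
  by apply: chart_image_open; exact: chart_dom_open.
have oc'd : open (c' @` (chart_dom c' `&` chart_dom d)).
  by apply: chart_image_open; exact: chart_dom_open.
have odc' : open (d @` (chart_dom d `&` chart_dom c')).
  by apply: chart_image_open; exact: chart_dom_open.
split=> k.
  apply: (@Ck_on_comp_mx _ _ _ _ _ _ _ Psi (d \o chart_inv c) oc'd ocd).
  - move=> _ [x [[cx Ux] dx] <-] /=; by rewrite PhiK //; exists x.
  - apply: Ck_on_sub (sPsi k) => _ [x [[cx Ux] dx] <-].
    by exists (c x).
  - exact: atlas_smooth ac ad k.
apply: (@Ck_on_comp_mx _ _ _ _ _ _ _ (c \o chart_inv d) Phi odc' oU).
- by move=> _ [x [dx [cx Ux]] <-] /=; rewrite chart_mapK ?inE.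
- apply: Ck_on_sub (atlas_smooth ad ac k) => _ [x [dx [cx Ux]] <-].
  by exists x.
- exact: sPhi.
Qed.

End Charts.

(** * The slice chart at a point *)

Lemma card_ord_geq (n k : nat) :
  (k <= n)%N -> #|[set i : 'I_n | (n - k <= i)%N]%SET| = k.
Proof.
move=> kn; rewrite -sum1_card; under eq_bigl do rewrite inE.
transitivity (\sum_(n - k <= i < n) 1)%N; first by rewrite big_geq_mkord.
by rewrite sum_nat_const_nat muln1 subKn.
Qed.

(** A linear relation among the differences becomes an affine relation once [v j0] receives minus
    the sum of the other coefficients. *)
Lemma affinely_independentB (R : realType) (V : lmodType R) (m : nat)
    (J : {set 'I_m}) (v : 'I_m -> V) (j0 : 'I_m) (a : 'I_m -> R) :
  affinely_independent J v -> j0 \in J ->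
  \sum_(j in (J :\ j0)%SET) a j *: (v j - v j0) = 0 ->
  forall j, j \in (J :\ j0)%SET -> a j = 0.
Proof.
move=> indep j0J a0 j; rewrite finset.in_setD1 => /andP[jj0 jJ].
pose b j := if j == j0 then - \sum_(j in (J :\ j0)%SET) a j else a j.
have bD1 (W : zmodType) (F : R -> 'I_m -> W) : \sum_(j in J) F (b j) j =
    F (b j0) j0 + \sum_(j in (J :\ j0)%SET) F (a j) j.
  rewrite (big_setD1 j0) //=; congr (_ + _); apply: eq_bigr => j'.
  by rewrite finset.in_setD1 /b => /andP[/negPf ->].
have := indep b _ _ j jJ; rewrite /b (negPf jj0); apply.
  by rewrite (bD1 _ (fun x _ => x)) /b eqxx addNr.
rewrite (bD1 _ (fun x j => x *: v j)) /b eqxx -[RHS]a0 scaleNr scaler_suml.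
rewrite -sumrN -big_split /=; apply: eq_bigr => j' _.
by rewrite scalerBr addrC.
Qed.

Lemma local_slice (R : realType) (n m : nat) (M : smoothManifold R n)
    (f : M -> R) (fs : 'I_m -> M -> R) (J : {set 'I_m}) (p : M) :
  CS_function f fs -> active_set f fs p = J ->
  (#|J| - 1 <= n)%N /\ exists c : chart R n M,
    [/\ smooth_chart c, chart_dom c p &
      c @` ([set x | active_set f fs x = J] `&` chart_dom c) =
      c @` chart_dom c `&`
        [set y | forall i : 'I_n, (n - (#|J| - 1) <= i)%N -> y 0 i = 0]].
Proof.
move=> [smf [cf f_neq0 _] _ aff] pJ.
have [c ac cp] := atlas_cover p.
have [j0 j0J] : exists j0, j0 \in J by apply/set0Pn; rewrite -pJ.
set V := c @` chart_dom c; have oV : open V := @chart_img_open _ _ _ c.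
pose F j := fs j \o chart_inv c.
have sF j : smooth_on V (F j) := smf j c ac.
have cfc y : V y -> {for y, continuous (f \o chart_inv c)}.
  move=> Vy; apply: continuous_comp; last exact: cf.
  by apply: (within_open_continuousP _ oV).1 Vy; exact: chart_inv_continuous.
(* On [W] only functions with index in [J] can be active. *)
pose W := V `&` [set y | forall j, j \notin J -> f (chart_inv c y) != F j y].
have Vcp : V (c p) by exists p.
have oW : open W.
  rewrite openE => y [Vy fFy].
  have nV : nbhs y V by exact: open_nbhs_nbhs.
  suff : \forall z \near y, forall j, j \notin J -> f (chart_inv c z) != F j z.
    by move=> nF; apply: filterI.
  apply: (@filter_forall _ _ _ _ (nbhs_filter y)) => j.
  have [jJ|jJ] := boolP (j \in J); first by near=> z.
  have : (fun z => f (chart_inv c z) - F j z) @ y --> f (chart_inv c y) - F j y.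
    exact: cvgB (cfc y Vy) (Ck_on_continuous oV (sF j 0%N) Vy).
  have : f (chart_inv c y) - F j y != 0 by rewrite subr_eq0 fFy.
  move=> ne0 /cvgr_neq0 /(_ ne0); apply: filterS => z.
  by rewrite subr_eq0.
have Wcp : W (c p).
  split=> // j; rewrite /F /= chart_mapK ?inE // -pJ inE; exact.
pose g j y := F j y - F j0 y.
have sg j : smooth_on W (g j).
  by move=> k; apply: Ck_on_sub (Ck_onB oV (sF j k) (sF j0 k)) => y [].
have dF j : differentiable (F j) (c p) by exact: (sF j 1%N).1.
have [|U [Phi [Psi [B [tau [D Ucp UW Bs BP]]]]]] :=
  @straighten_independent R n 'I_m j0 g (enum (J :\ j0)%SET) W (c p) oW Wcp
    (enum_uniq _) (fun j _ => sg j).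
  move=> a a0 j; rewrite mem_enum.
  apply: (affinely_independentB
    (v := fun j => gradient_in_chart c (fs j) p) _ j0J).
    by rewrite -{1}pJ; exact: aff.
  apply/rowP => l; rewrite summxE mxE -[RHS](a0 l) big_enum /=.
  apply: eq_bigr => j' _; rewrite !mxE /g deriveB //; exact: diff_derivable.
have cardB : (#|J| - 1 = #|B|)%N.
  move/perm_size: Bs; rewrite size_map -!cardE => <-.
  by rewrite (cardsD1 j0 J) j0J addKn.
have kn : (#|J| - 1 <= n)%N by rewrite cardB -[leqRHS]card_ord max_card.
split=> //.
(* Coordinate [i] of [col_perm t y] is coordinate [t i] of [y], so this [t] makes the straightened
   coordinates the last ones. *)
have [t tP] : exists t : 'S_n, forall i, (t i \in B) = (n - (#|J| - 1) <= i)%N.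
  have := perm_of_eq_card (etrans (card_ord_geq kn) cardB).
  by move=> [t tP]; exists t => i; rewrite tP inE.
have D' := local_diffeo_comp D (local_diffeo_col_perm t).
rewrite preimage_setT setIT in D'.
have Uc : U `<=` c @` chart_dom c by move=> y /UW[].
exists (chart_comp D' Uc); split.
- exact: smooth_chart_comp.
- by split.
(* For the converse, the vanishing coordinates make all [fs j x] with [j] in [J] equal. Some index
   is active at [x], and it lies in [J] because [c x] is in [W]; hence exactly [J] is active. *)
have SP x : chart_dom c x -> U (c x) ->
    active_set f fs x = J <-> (forall i, i \in B -> Phi (c x) 0 i = 0).
  move=> cx Ux; have [_ xW] := UW _ Ux.
  have FE j : F j (c x) = fs j x by rewrite /F /= chart_mapK ?inE.
  have {}xW j : j \notin J -> f x != fs j x.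
    by move=> jJ; have := xW j jJ; rewrite FE chart_mapK ?inE.
  split=> [xJ i iB|Phi0].
    have : tau i \in enum (J :\ j0)%SET.
      by rewrite (perm_mem Bs) map_f // mem_enum.
    rewrite mem_enum finset.in_setD1 => /andP[_].
    rewrite BP // /g !FE -xJ inE => /eqP <-.
    by move: j0J; rewrite -xJ inE => /eqP <-; rewrite subrr.
  have fsj0 j : j \in J -> fs j x = fs j0 x.
    have [->//|jj0 jJ] := eqVneq j j0.
    have : j \in enum (J :\ j0)%SET by rewrite mem_enum finset.in_setD1 jj0.
    rewrite (perm_mem Bs) => /mapP[i]; rewrite mem_enum => iB ->.
    by apply/eqP; rewrite -subr_eq0 -!FE; apply/eqP; rewrite -(Phi0 i iB) BP.
  have [j1] : exists j1, j1 \in active_set f fs x by exact/set0Pn.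
  rewrite inE => /eqP fj1.
  have j1J : j1 \in J by apply: contraT => /xW; rewrite fj1 eqxx.
  apply/setP => j; rewrite inE; have [jJ|/xW/negbTE//] := boolP (j \in J).
  by rewrite fj1 (fsj0 _ j1J) (fsj0 _ jJ) eqxx.
apply/seteqP; split.
  move=> _ [x [/= xJ [cx Ux]] <-]; split; first by exists x.
  move=> i ni; rewrite /= mxE; apply: (SP x cx Ux).1 => //.
  by rewrite tP.
move=> _ [[x [cx Ux] <-] /= y0]; exists x => //; split=> //.
apply/(SP x cx Ux) => i iB.
have := y0 (t^-1%g i); rewrite mxE permKV; apply.
by rewrite -tP permKV.
Unshelve. all: by end_near. Qed.

Local Close Scope ring_scope.
Local Close Scope classical_set_scope.

Theorem proposition3p4 (R : realType) (n m : nat) (M : smoothManifold R n)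
    (f : M -> R) (fs : 'I_m -> M -> R) (hf : CS_function f fs)
    (J : {set 'I_m}) (hJ : exists x : M, active_set f fs x = J) :
  submanifold_codim (#|J| - 1) [set x : M | active_set f fs x = J]%classic.
Proof.
split; first by have [x xJ] := hJ; have [] := local_slice hf xJ.
by move=> p pJ; have [] := local_slice hf pJ.
Qed.
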